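(* There exist an integral domain $D$ and a star operation $\ast$ on $D$ such that $\ast$ is eab but $\ast$ is not ab.
   Context: Let $D$ be an integral domain with quotient field $K$. $\boldsymbol F(D)$ is the set of all nonzero fractional ideals of $D$, and $\boldsymbol f(D)$ is the set of all nonzero finitely generated fractional ideals of $D$. A star operation of $D$ is a map $\ast:\boldsymbol F(D)\to\boldsymbol F(D)$, $E\mapsto E^\ast$, such that for all $0\ne z\in K$ and all $E,F\in\boldsymbol F(D)$: $(zD)^\ast=zD$ and $(zE)^\ast=zE^\ast$; $E\subseteq F$ implies $E^\ast\subseteq F^\ast$; $E\subseteq E^\ast$ and $(E^\ast)^\ast=E^\ast$. $\ast$ is eab if, for all $F,G,H\in\boldsymbol f(D)$, $(FG)^\ast\subseteq(FH)^\ast$ implies $G^\ast\subseteq H^\ast$; $\ast$ is ab if the same implication holds for all $F\in\boldsymbol f(D)$ and all $G,H\in\boldsymbol F(D)$. *)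

(* Defs.v *)
From HB Require Import structures.
From mathcomp Require Import all_boot all_algebra.
From mathcomp Require Import boolp classical_sets.

Set Implicit Arguments.
Unset Strict Implicit.
Unset Printing Implicit Defensive.

Import GRing.Theory.
Local Open Scope classical_set_scope.
Local Open Scope ring_scope.

(* Subsets of the quotient field K = {fraction D} of D; the embedding of D   *)
(* into K is x |-> x%:F.                                                     *)
Local Notation "x %:F" := (@FracField.tofrac _ x) : ring_scope.

(* Nonzero by convention: this is membership in F(D), which excludes {0}. *)
Record fractional_ideal (D : idomainType) (E : set {fraction D}) : Prop :=
  FractionalIdeal {
    fractional_ideal0 : E 0;
    fractional_idealD : forall x y, E x -> E y -> E (x + y);
    fractional_idealZ : forall (a : D) x, E x -> E (a%:F * x);
    fractional_ideal_neq0 : exists2 x, E x & x != 0;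
    fractional_ideal_denom : exists2 d : D, d != 0 &
      forall x, E x -> exists a : D, d%:F * x = a%:F }.

Definition finitely_generated (D : idomainType) (E : set {fraction D}) : Prop :=
  exists (n : nat) (g : 'I_n -> {fraction D}),
    E = [set x | exists a : 'I_n -> D, x = \sum_(i < n) (a i)%:F * g i].

Definition fg_fractional_ideal (D : idomainType) (E : set {fraction D}) : Prop :=
  fractional_ideal E /\ finitely_generated E.

Definition scale_ideal (D : idomainType) (z : {fraction D})
    (E : set {fraction D}) : set {fraction D} :=
  [set z * x | x in E].

Definition principal_ideal (D : idomainType) (z : {fraction D}) :
    set {fraction D} :=
  [set z * a%:F | a in [set: D]].

(* EF: the set of finite sums of products x * y with x in E and y in F. *)
Definition mul_ideal (D : idomainType) (E F : set {fraction D}) :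
    set {fraction D} :=
  [set x | exists (n : nat) (e f : 'I_n -> {fraction D}),
    [/\ forall i, E (e i), forall i, F (f i) & x = \sum_(i < n) e i * f i]].

(* A map F(D) -> F(D) is encoded as a total function on the subsets of K     *)
(* preserving F(D); its values outside F(D) are irrelevant.                  *)
Record star_operation (D : idomainType)
    (star : set {fraction D} -> set {fraction D}) : Prop :=
  StarOperation {
    star_fractional_ideal : forall E,
      fractional_ideal E -> fractional_ideal (star E);
    star_principal : forall z, z != 0 ->
      star (principal_ideal z) = principal_ideal z;
    star_scale : forall z E, z != 0 -> fractional_ideal E ->
      star (scale_ideal z E) = scale_ideal z (star E);
    star_mono : forall E F, fractional_ideal E -> fractional_ideal F ->
      E `<=` F -> star E `<=` star F;
    star_ext : forall E, fractional_ideal E -> E `<=` star E;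
    star_idem : forall E, fractional_ideal E -> star (star E) = star E }.

Definition eab (D : idomainType)
    (star : set {fraction D} -> set {fraction D}) : Prop :=
  forall F G H, fg_fractional_ideal F -> fg_fractional_ideal G ->
    fg_fractional_ideal H ->
    star (mul_ideal F G) `<=` star (mul_ideal F H) -> star G `<=` star H.

Definition ab (D : idomainType)
    (star : set {fraction D} -> set {fraction D}) : Prop :=
  forall F G H, fg_fractional_ideal F -> fractional_ideal G ->
    fractional_ideal H ->
    star (mul_ideal F G) `<=` star (mul_ideal F H) -> star G `<=` star H.

(* Main.v *)
Require Import Defs.
From HB Require Import structures.
From mathcomp Require Import all_boot all_algebra.
From mathcomp Require Import boolp classical_sets.
From mathcomp Require Import zify.

(* Let k be a field, L = k(x), and let D = k + t L[t] be the ring of polynomials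
   over L with constant term in k. A k-subspace W of L gives the D-submodule
   lift W = W + t L[t] of K = Frac D. Given a family of such subspaces, sending E
   to the intersection of all z (lift W) containing E is a star operation as
   soon as W = k is in the family. We take the spaces P m of polynomials in x of
   degree at most m, together with the space J of fractions having at most
   simple poles, all in a fixed infinite set {a_0, a_1, ...} of points of k, and
   no pole at infinity (a Riemann-Roch space of an infinite divisor).

   Clearing content twice, first in L[t] and then in k[x], shows that the closure
   of a finitely generated ideal is z (lift (P m)) for some z and m; as
   P m * P n <= P (m + n) and (P (m + n) : P m) = P n, the operation is eab.
   On the other hand no z (lift W) of the family contains lift J + x lift J
   without containing L[t]: for W = P m because J has infinitely many poles,
   and for W = J because multiplying by x adds a pole at infinity which no
   scaling can move into the a_i. Hence F = (1, x), G = L[t] and H = lift J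
   contradict ab. *)

Set Implicit Arguments.
Unset Strict Implicit.
Unset Printing Implicit Defensive.

Import GRing.Theory.
Local Open Scope classical_set_scope.
Local Open Scope ring_scope.

Local Notation "x %:F" := (@FracField.tofrac _ x) : ring_scope.

(** * Elements of a fraction field as quotients *)

Lemma fractionP (R : idomainType) (x : {fraction R}) :
  exists n d : R, d != 0 /\ x = n%:F / d%:F.
Proof.
elim/quotW: x => x; exists (frac x).1, (frac x).2; split.
  exact: denom_ratioP.
have d0 : (frac x).2%:F != 0 :> {fraction R} by rewrite tofrac_eq0 denom_ratioP.
apply: (mulIf d0); rewrite divfK //.
unlock FracField.tofrac; rewrite -[LHS]FracField.pi_mul.
apply/eqmodP; rewrite /= FracField.equivfE /FracField.mulf.
rewrite !numden_Ratio ?(oner_neq0, mulf_neq0, mulr1, denom_ratioP) //.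
by rewrite mulrC.
Qed.

Lemma tofrac_inj (R : idomainType) : injective (@FracField.tofrac R).
Proof. by move=> x y /eqP; rewrite tofrac_eq => /eqP. Qed.

(** * Star operations defined by a family of submodules *)

Section FamilyStar.
Variables (D : idomainType) (CC : set (set {fraction D})).
Hypothesis CCD : forall C, CC C -> forall x y, C x -> C y -> C (x + y).
Hypothesis CCZ : forall C, CC C -> forall (a : D) x, C x -> C (a%:F * x).
Hypothesis CC1 : CC (principal_ideal 1).

(** With z = y^-1 this is the intersection of all z C, C in [CC], that contain E. The multiplier
    form turns a change of scale into a product. *)
Definition family_star (E : set {fraction D}) : set {fraction D} :=
  [set x | forall y C, y != 0 -> CC C ->
     (forall e, E e -> C (y * e)) -> C (y * x)].

Lemma sub_family_star E : E `<=` family_star E.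
Proof. by move=> x Ex y C _ _; exact. Qed.

Lemma family_star_mono E F : E `<=` F -> family_star E `<=` family_star F.
Proof. by move=> EF x Ex y C y0 CC_C FC; apply: Ex => // e /EF/FC. Qed.

Lemma family_star_idem E : family_star (family_star E) = family_star E.
Proof.
apply/seteqP; split; last exact: sub_family_star.
by move=> x Ex y C y0 CC_C EC; apply: Ex => // e Ee; apply: Ee.
Qed.

(** Membership of D itself in the family, by [CC1], gives two of the axioms: a common denominator of
    E remains one for its closure, and principal ideals are closed. *)
Lemma family_starP : star_operation family_star.
Proof.
split.
- move=> E [E0 ED EZ [x Ex x0] [d d0 dE]]; split.
  + exact: sub_family_star.
  + move=> u v uE vE y C y0 CC_C EC; rewrite mulrDr.
    by apply: CCD => //; [apply: uE | apply: vE].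
  + move=> a u uE y C y0 CC_C EC; rewrite mulrCA.
    by apply: CCZ => //; apply: uE.
  + by exists x => //; exact: sub_family_star.
  + exists d => // u uE.
    have [||e /dE[a ->]|a _ <-] := uE d%:F (principal_ideal 1).
    * by rewrite tofrac_eq0.
    * exact: CC1.
    * by exists a => //; rewrite mul1r.
    * by exists a; rewrite mul1r.
- move=> z z0; apply/seteqP; split; last exact: sub_family_star.
  move=> x xE.
  have [||e [a _ <-]|a _ E] := xE z^-1 (principal_ideal 1).
  + by rewrite invr_eq0.
  + exact: CC1.
  + by exists a => //; rewrite mulKf // mul1r.
  + by exists a => //; rewrite -(mul1r a%:F) E mulVKf.
- move=> z E z0 _; apply/seteqP; split => x.
  + move=> xE; exists (z^-1 * x); last by rewrite mulVKf.
    move=> y C y0 CC_C EC; rewrite mulrA.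
    apply: xE => //; first exact: mulf_neq0 y0 (invr_neq0 z0).
    by move=> _ [e Ee <-]; rewrite -mulrA mulKf //; apply: EC.
  + move=> [u uE <-] y C y0 CC_C EC; rewrite mulrA.
    apply: uE => //; first exact: mulf_neq0 y0 z0.
    by move=> e Ee; rewrite -mulrA; apply: EC; exists e.
- by move=> E F _ _; exact: family_star_mono.
- by move=> E _; exact: sub_family_star.
- by move=> E _; exact: family_star_idem.
Qed.

End FamilyStar.

(** * Clearing content in polynomial rings over a field *)

Lemma polys_principal (F : fieldType) n (e : 'I_n -> {poly F}) :
  exists (h : {poly F}) (w b : 'I_n -> {poly F}),
    (forall i, e i = h * w i) /\ h = \sum_(i < n) b i * e i.
Proof.
elim: n e => [|n IHn] e.
  by exists 0, (fun=> 0), (fun=> 0); split=> [[]//|]; rewrite big_ord0.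
have [h [w [b [ew hb]]]] := IHn (fun i => e (lift ord0 i)).
have [[u v] /= uv] := Bezoutp (e ord0) h.
(* A Bezout combination, associate to the gcd, is taken as generator, so that the linear relation is
   exact. *)
set g := u * e ord0 + v * h in uv.
have gd : (g %| e ord0) && (g %| h).
  by rewrite !(eqp_dvdl _ uv) dvdp_gcdl dvdp_gcdr.
have {gd} [/divpK g0 /divpK gh] := andP gd.
exists g, (fun i => if unlift ord0 i is Some j then (h %/ g) * w j
                    else e ord0 %/ g),
  (fun i => if unlift ord0 i is Some j then v * b j else u); split.
  move=> i; case: unliftP => [j ->|->]; last by rewrite mulrC g0.
  by rewrite ew mulrA (mulrC g) gh.
rewrite big_ord_recl unlift_none; congr (_ + _).
rewrite [in LHS]hb mulr_sumr; apply: eq_bigr => i _.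
by rewrite liftK mulrA.
Qed.

(** Once a common denominator is cleared, the gcd splits off as content and the cofactors are
    unimodular. The morphism [phi] is abstract because this serves twice: for L[X] in K and for F[x]
    in F(x). *)
Lemma frac_unimodular (F K : fieldType) (phi : {rmorphism {poly F} -> K})
    n (g : 'I_n -> K) :
  injective phi ->
  (forall x, exists p q, q != 0 /\ x = phi p / phi q) ->
  (exists i, g i != 0) ->
  exists (f : K) (w b : 'I_n -> {poly F}),
    [/\ f != 0, forall i, g i = f * phi (w i) & \sum_(i < n) b i * w i = 1].
Proof.
move=> phi_inj frac [i0 gi0].
have phi0 p : (phi p == 0) = (p == 0) by rewrite -(inj_eq phi_inj) rmorph0.
have /choice[p /choice[q pq]] := fun i => frac (g i).
pose d := \prod_i q i.
have d0 : phi d != 0.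
  by rewrite phi0; apply/prodf_neq0 => i _; have [] := pq i.
pose e i := p i * \prod_(j | j != i) q j.
have ge i : g i = phi (e i) / phi d.
  have [qi0 ->] := pq i.
  have qd : d = q i * \prod_(j | j != i) q j by rewrite /d (bigD1 i).
  apply/eqP; rewrite eqr_div //; last by rewrite phi0.
  rewrite -!rmorphM qd.
  by apply/eqP; congr (phi _); rewrite /e mulrA mulrAC.
have [h [w [b [ew hb]]]] := polys_principal e.
have h0 : h != 0.
  by apply: contra_neq gi0 => h0; rewrite ge ew h0 mul0r rmorph0 mul0r.
exists (phi h / phi d), w, b; split.
- by rewrite mulf_neq0 ?invr_eq0 // phi0.
- by move=> i; rewrite ge ew rmorphM mulrAC.
- apply: (mulfI h0); rewrite mulr1 [RHS]hb mulr_sumr.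
  by apply: eq_bigr => i _; rewrite ew mulrCA.
Qed.

(** * The ring k + X L[X] and its submodules *)

Section Pullback.
Variables (L : fieldType) (k : divringClosed L).

Definition pullback_pred := [pred p : {poly L} | p`_0 \in k].

Lemma pullback_divring_closed : divring_closed pullback_pred.
Proof.
split=> [|p q|p q]; rewrite !inE.
- by rewrite coefC eqxx rpred1.
- by rewrite coefB; apply: rpredB.
- move=> pk qk; rewrite coef0M rpredM //.
  (* By convention a nonunit is its own inverse; a unit is a constant, whose inverse is again in
     [k]. *)
  case: (boolP (q \is a GRing.unit)) => [|/invr_out->//].
  by move=> q_unit; rewrite poly_invE q_unit coefC eqxx rpredV.
Qed.

HB.instance Definition _ :=
  GRing.isDivringClosed.Build {poly L} pullback_pred pullback_divring_closed.

Record pullback := Pullback { pullback_val :> {poly L};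
                              _ : pullback_val \in pullback_pred }.

HB.instance Definition _ := [isSub for pullback_val].
HB.instance Definition _ := [Choice of pullback by <:].
HB.instance Definition _ := [SubChoice_isSubIntegralDomain of pullback by <:].

Local Notation K := {fraction pullback}.

Fact pullback_mulX_subproof (p : {poly L}) : 'X * p \in pullback_pred.
Proof. by rewrite inE coefXM rpred0. Qed.

Definition pullback_mulX (p : {poly L}) : pullback :=
  Pullback (pullback_mulX_subproof p).

Lemma pullback_mulX1_neq0 : (pullback_mulX 1)%:F != 0 :> K.
Proof.
by rewrite tofrac_eq0 -(inj_eq val_inj) rmorph0 /= mulr1 polyX_eq0.
Qed.

(* L[X] embeds into the quotient field of k + X L[X] as X p is in the ring. *)
Definition frac_of_poly (p : {poly L}) : K :=
  (pullback_mulX p)%:F / (pullback_mulX 1)%:F.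

Lemma frac_of_polyE p :
  frac_of_poly p * (pullback_mulX 1)%:F = (pullback_mulX p)%:F.
Proof. by rewrite divfK ?pullback_mulX1_neq0. Qed.

Lemma frac_of_poly_is_zmod_morphism : zmod_morphism frac_of_poly.
Proof.
move=> p q; rewrite /frac_of_poly -mulrBl -rmorphB.
by congr (_%:F / _); apply: val_inj; rewrite rmorphB /= mulrBr.
Qed.

Lemma frac_of_poly_is_monoid_morphism : monoid_morphism frac_of_poly.
Proof.
split=> [|p q]; first by rewrite /frac_of_poly divff ?pullback_mulX1_neq0.
apply: (mulIf pullback_mulX1_neq0); apply: (mulIf pullback_mulX1_neq0).
rewrite -[RHS]mulrA mulrACA !frac_of_polyE -!rmorphM; congr (_%:F).
by apply: val_inj; rewrite !rmorphM /= mulr1 mulrACA -!mulrA; congr (_ * _);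
   rewrite mulrA mulrC.
Qed.

HB.instance Definition _ := GRing.isZmodMorphism.Build {poly L} K frac_of_poly
  frac_of_poly_is_zmod_morphism.
HB.instance Definition _ := GRing.isMonoidMorphism.Build {poly L} K frac_of_poly
  frac_of_poly_is_monoid_morphism.

Lemma frac_of_poly_inj : injective frac_of_poly.
Proof.
move=> p q pq; apply: (mulfI (negbT (polyX_eq0 L))).
have : pullback_mulX p = pullback_mulX q.
  by apply/eqP; rewrite -tofrac_eq -(frac_of_polyE p) pq frac_of_polyE.
by move/(congr1 val).
Qed.

Lemma frac_of_poly_val (a : pullback) : frac_of_poly a = a%:F.
Proof.
apply: (mulIf pullback_mulX1_neq0); rewrite frac_of_polyE -rmorphM.
by congr (_%:F); apply: val_inj; rewrite rmorphM /= mulr1 mulrC.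
Qed.

Lemma frac_of_polyP (x : K) :
  exists p q, q != 0 /\ x = frac_of_poly p / frac_of_poly q.
Proof.
have [n [d [d0 ->]]] := fractionP x.
by exists (pullback_val n), (pullback_val d); rewrite !frac_of_poly_val.
Qed.

Definition lift_set (W : set L) : set K :=
  [set frac_of_poly p | p in [set p : {poly L} | W p`_0]].

Definition subspace (W : set L) :=
  [/\ W 0, forall x y, W x -> W y -> W (x + y) &
      forall a x, a \in k -> W x -> W (a * x)].

Lemma lift_setP W (p : {poly L}) : lift_set W (frac_of_poly p) <-> W p`_0.
Proof. by split=> [[q Wq /frac_of_poly_inj<-]//|]; exists p. Qed.

Lemma lift_set0 W : subspace W -> lift_set W 0.
Proof. by case=> W0 _ _; exists 0; rewrite ?rmorph0 //= coef0. Qed.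

Lemma lift_setD W : subspace W ->
  forall x y, lift_set W x -> lift_set W y -> lift_set W (x + y).
Proof.
move=> [_ WD _] _ _ [p Wp <-] [q Wq <-]; rewrite -rmorphD; apply/lift_setP.
by rewrite coefD; apply: WD.
Qed.

Lemma lift_setZ W : subspace W ->
  forall (a : pullback) x, lift_set W x -> lift_set W (a%:F * x).
Proof.
move=> [_ _ WZ] a _ [p Wp <-].
rewrite -frac_of_poly_val -rmorphM; apply/lift_setP.
by rewrite coef0M; apply: WZ => //; case: a.
Qed.

Lemma principal_idealE : principal_ideal 1 = lift_set [set` k].
Proof.
apply/seteqP; split=> [_ [a _ <-]|_ [p kp <-]].
  by exists a; rewrite ?mul1r ?frac_of_poly_val //=; case: a.
by exists (@Pullback p kp); rewrite // mul1r -frac_of_poly_val.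
Qed.

Lemma lift_set_fractional W c :
  subspace W -> W c -> c != 0 -> fractional_ideal (lift_set W).
Proof.
move=> Wsub Wc c0; split.
- exact: lift_set0.
- exact: lift_setD.
- exact: lift_setZ.
- exists (frac_of_poly c%:P); first by apply/lift_setP; rewrite coefC eqxx.
  by rewrite -(rmorph0 frac_of_poly) (inj_eq frac_of_poly_inj) polyC_eq0.
(* X is a common denominator, since X L[X] lies in D. *)
- exists (pullback_mulX 1).
    by have := pullback_mulX1_neq0; rewrite tofrac_eq0.
  by move=> _ [p _ <-]; exists (pullback_mulX p); rewrite mulrC frac_of_polyE.
Qed.

(** As [lift_set W] lies in L[X], the Bezout relation forces y into L[X]; what remains is a
    condition on constant coefficients. *)
Lemma lift_set_colon W n (w b : 'I_n -> {poly L}) (y : K) :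
  \sum_(i < n) b i * w i = 1 ->
  (forall i, lift_set W (y * frac_of_poly (w i))) ->
  exists2 p, y = frac_of_poly p & forall i, W (p`_0 * (w i)`_0).
Proof.
move=> bw yw.
have /choice[q qP] : forall i, exists q,
    frac_of_poly q = y * frac_of_poly (w i).
  by move=> i; have [q _ qE] := yw i; exists q.
have yE : y = frac_of_poly (\sum_(i < n) b i * q i).
  rewrite -[LHS]mulr1 -(rmorph1 frac_of_poly) -bw !rmorph_sum mulr_sumr.
  by apply: eq_bigr => i _; rewrite !rmorphM /= qP mulrCA.
exists (\sum_(i < n) b i * q i) => // i.
by have := yw i; rewrite yE -rmorphM => /lift_setP; rewrite coef0M.
Qed.

End Pullback.

(** * The star operation of a family of subspaces of L *)

Section PullbackStar.
Variables (L : fieldType) (k : divringClosed L).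
Variables (P : nat -> set L) (J : set L) (t : L).

Definition subspace_family : set (set L) :=
  [set W | (exists m, W = P m) \/ W = J].

Hypothesis P0 : P 0 = [set` k].
Hypothesis Psub : forall m, subspace k (P m).
Hypothesis Jsub : subspace k J.
Hypothesis P1 : forall m, P m 1.
Hypothesis PM : forall m n x y, P m x -> P n y -> P (m + n)%N (x * y).
Hypothesis Pcolon : forall m n c,
  (forall q, P m q -> P (m + n)%N (c * q)) -> P n c.
(* Up to scaling, the closure of a finite-dimensional subspace is some P m. *)
Hypothesis Phull : forall n (w : 'I_n -> L), (exists i, w i != 0) ->
  exists u m, [/\ u != 0, forall i, P m (u * w i) &
    forall c W, subspace_family W -> (forall i, W (c * (u * w i))) ->
    forall q, P m q -> W (c * q)].

Local Notation K := {fraction pullback k}.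
Local Notation lift := (@lift_set L k).
Local Notation iota := (@frac_of_poly L k).

Definition pullback_star : set K -> set K :=
  family_star [set C | exists2 W, subspace_family W & C = lift W].

Lemma subspace_familyP W : subspace_family W -> subspace k W.
Proof. by case=> [[m ->]|->]. Qed.

Lemma pullback_starP : star_operation pullback_star.
Proof.
apply: family_starP.
- by move=> _ [W /subspace_familyP Wsub ->]; exact: (lift_setD Wsub).
- by move=> _ [W /subspace_familyP Wsub ->]; exact: (lift_setZ Wsub).
- by exists (P 0); [left; exists 0%N | rewrite P0 principal_idealE].
Qed.

(** The closure of F is thus f times the lift of [P m]. Content is cleared first in L[X], leaving a
    unimodular [w], and then among the constant coefficients of [w], by [Phull]. *)
Lemma fg_hull F : fg_fractional_ideal F ->
  exists (f : K) (m : nat), [/\ f != 0,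
    forall x, F x -> lift (P m) (f^-1 * x) &
    forall y W, subspace_family W -> (forall x, F x -> lift W (y * x)) ->
    forall x, lift (P m) x -> lift W (y * f * x)].
Proof.
move=> [[_ _ _ [x0 Fx0 x00] _] [n [g FE]]].
have Fg i : F (g i).
  rewrite FE; exists (fun j => (j == i)%:R).
  rewrite (bigD1 i) //= eqxx rmorph1 mul1r big1 ?addr0 // => j /negbTE->.
  by rewrite rmorph0 mul0r.
have g_neq0 : exists i, g i != 0.
  apply: contrapT => g0; move: Fx0 x00; rewrite FE => -[a ->].
  rewrite big1 ?eqxx //.
  move=> i _; case: (eqVneq (g i) 0) => [->|gi]; first by rewrite mulr0.
  by case: g0; exists i.
have [f [w [b [f0 gw bw]]]] :=
  frac_unimodular (@frac_of_poly_inj L k) (@frac_of_polyP L k) g_neq0.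
(* The Bezout relation, read at X = 0, keeps some constant coefficient nonzero. *)
have w_neq0 : exists i, (w i)`_0 != 0.
  apply: contrapT => w0; have /eqP := congr1 (fun p : {poly L} => p`_0) bw.
  rewrite coef_sum coefC eqxx big1 1?eq_sym ?oner_eq0 // => i _.
  rewrite coef0M; case: (eqVneq (w i)`_0 0) => [->|wi]; first by rewrite mulr0.
  by case: w0; exists i.
have [u [m [u0 Puw Pmin]]] := Phull w_neq0.
have iu0 : iota u%:P != 0.
  by rewrite -(rmorph0 iota) (inj_eq (@frac_of_poly_inj L k)) polyC_eq0.
have iuV : (iota u%:P)^-1 = iota (u^-1)%:P.
  by apply: (mulfI iu0); rewrite divff // -rmorphM -polyCM divff // rmorph1.
have [P_0 P_D P_Z] := Psub m.
exists (f / iota u%:P), m; split.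
- exact: mulf_neq0 f0 (invr_neq0 iu0).
- move=> x; rewrite FE => -[a ->].
  have -> : (f / iota u%:P)^-1 * \sum_(i < n) (a i)%:F * g i
      = iota (\sum_(i < n) u%:P * (pullback_val (a i) * w i)).
    rewrite invf_div mulr_sumr rmorph_sum; apply: eq_bigr => i _.
    rewrite gw -frac_of_poly_val !rmorphM -mulrA; congr (_ * _).
    by rewrite (mulrCA _ f) mulKf.
  apply/lift_setP; rewrite coef_sum; elim/big_ind: _ => // i _.
  by rewrite !coef0M coefC eqxx mulrCA; apply: P_Z => //; case: (a i).
- move=> y W WW yF x [q Pq <-].
  (* [y * f] is a polynomial p, and [Phull] will be applied with c = p(0) / u. *)
  have [|p yfp Wp] := @lift_set_colon _ k W n w b (y * f) bw.
    by move=> i; rewrite -mulrA -gw; apply: yF.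
  rewrite (mulrA y) yfp iuV -!rmorphM; apply/lift_setP.
  rewrite !coef0M coefC eqxx; apply: Pmin => // i.
  by rewrite mulrA divfK.
Qed.

(** Let f lift (P m) and h lift (P n) be the hulls of F and H. For x in G, F x lies in the closure
    of FH, hence in f h lift (P (m + n)). So x / h carries lift (P m) into lift (P (m + n)), and
    [Pcolon] puts x / h into lift (P n). *)
Lemma pullback_star_eab : eab pullback_star.
Proof.
move=> F G H Ffg Gfg Hfg FGH.
suff GH : G `<=` pullback_star H.
  by rewrite -[X in _ `<=` X]family_star_idem; apply: family_star_mono.
move=> x Gx y _ y0 [W WW ->] yH.
have [f [m [f0 Ff Fmin]]] := fg_hull Ffg.
have [h [n [h0 Hh Hmin]]] := fg_hull Hfg.
have -> : y * x = y * h * (h^-1 * x) by rewrite mulrA mulfK.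
apply: (Hmin _ _ WW yH).
have fh0 : f^-1 / h != 0 by exact: mulf_neq0 (invr_neq0 f0) (invr_neq0 h0).
have PW i : subspace_family (P i) by left; exists i.
have xF e : F e -> lift (P (m + n)) (f^-1 / h * x * e).
  move=> Fe; rewrite -mulrA (mulrC x).
  have /FGH FHex : pullback_star (mul_ideal F G) (e * x).
    apply: sub_family_star; exists 1%N, (fun=> e), (fun=> x).
    by split=> //; rewrite big_ord1.
  apply: FHex => //; first by exists (P (m + n)).
  move=> _ [r [e' [h' [Fe' Hh' ->]]]]; rewrite mulr_sumr.
  elim/big_ind: _; first exact/lift_set0/Psub.
    exact/lift_setD/Psub.
  move=> i _; rewrite mulrACA.
  have [p Pp <-] := Ff _ (Fe' i); have [q Pq <-] := Hh _ (Hh' i).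
  by rewrite -rmorphM; apply/lift_setP; rewrite coef0M; apply: PM.
have zP := Fmin _ _ (PW _) xF.
have zE : f^-1 / h * x * f = h^-1 * x by rewrite mulrC -mulrA (mulVKf f0).
rewrite zE in zP.
(* Since 1 is in [P m], x / h is itself a polynomial, and only its constant coefficient matters. *)
have [p _ pE] : lift (P (m + n)) (h^-1 * x).
  rewrite -[_ * x]mulr1; apply: zP.
  by exists 1; rewrite ?rmorph1 //= coefC eqxx.
rewrite -pE; apply/lift_setP; apply: (@Pcolon m) => q Pq.
have /zP : lift (P m) (iota q%:P) by apply/lift_setP; rewrite coefC eqxx.
by rewrite -pE -rmorphM => /lift_setP; rewrite coef0M coefC eqxx.
Qed.

Hypothesis J1 : J 1.
Hypothesis Jproper : exists l, ~ J l.
Hypothesis Jhull : forall c W, subspace_family W ->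
  (forall x, J x -> W (c * x) /\ W (c * (t * x))) -> c = 0.

(** Here [t] is an element of L, and X is the variable of L[X]. A multiplier sending F times
    [lift J] into [lift W] is a polynomial whose constant coefficient vanishes by [Jhull], so it
    sends L[X] into X L[X], hence into [lift W]. But [lift J] is closed and smaller than L[X]. *)
Lemma pullback_star_not_ab : ~ ab pullback_star.
Proof.
pose g (i : 'I_2) : K := if i == ord0 then 1 else iota t%:P.
pose F : set K := [set x | exists a : 'I_2 -> pullback k,
                     x = \sum_(i < 2) (a i)%:F * g i].
have subT : subspace k [set: L] by [].
have fT : fractional_ideal (lift [set: L]).
  by apply: (@lift_set_fractional _ _ _ 1) => //; exact: oner_neq0.
have Fg i : F (g i).
  exists (fun j => (j == i)%:R).
  rewrite (bigD1 i) //= eqxx rmorph1 mul1r big1 ?addr0 // => j /negbTE->.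
  by rewrite rmorph0 mul0r.
have Ffg : fg_fractional_ideal F.
  split; last by exists 2%N, g.
  split.
  - by exists (fun=> 0); rewrite big1 // => i _; rewrite rmorph0 mul0r.
  - move=> _ _ [a ->] [b ->]; exists (fun i => a i + b i).
    by rewrite -big_split; apply: eq_bigr => i _; rewrite rmorphD mulrDl.
  - move=> c _ [a ->]; exists (fun i => c * a i).
    by rewrite mulr_sumr; apply: eq_bigr => i _; rewrite rmorphM mulrA.
  - by exists (g ord0) => //; rewrite /g eqxx oner_neq0.
  (* F lies in L[X], so a denominator of L[X] serves for F. *)
  - have [_ _ _ _ [d d0 dT]] := fT; exists d => // _ [a ->]; apply: dT.
    elim/big_ind: _; [exact: lift_set0|exact: lift_setD|move=> i _].
    apply: lift_setZ => //; rewrite /g; case: ifP => _; last by exists t%:P.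
    by exists 1; rewrite ?rmorph1.
have FB x : F x -> exists p : {poly L}, x = iota p.
  move=> [a ->].
  exists (\sum_(i < 2) pullback_val (a i) * (if i == ord0 then 1 else t%:P)).
  rewrite rmorph_sum; apply: eq_bigr => i _.
  by rewrite -frac_of_poly_val [RHS]rmorphM /g; case: ifP; rewrite ?rmorph1.
have F1 : F 1 by have := Fg ord0; rewrite /g eqxx.
have Ft : F (iota t%:P) by have := Fg ord_max; rewrite /g.
have liftC W l : W l -> lift W (iota l%:P).
  by move=> Wl; apply/lift_setP; rewrite coefC eqxx.
have fJ : fractional_ideal (lift J).
  by apply: (@lift_set_fractional _ _ _ 1) => //; exact: oner_neq0.
move=> /(_ F (lift [set: L]) (lift J) Ffg fT fJ) abF.
have FTJ :
    mul_ideal F (lift [set: L]) `<=` pullback_star (mul_ideal F (lift J)).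
  move=> _ [n [e [b [Fe Tb ->]]]] y _ y0 [W WW ->] yFJ.
  have Wsub := subspace_familyP WW.
  have yM x l : F x -> J l -> lift W (y * (x * iota l%:P)).
    move=> Fx Jl; apply: yFJ.
    exists 1%N, (fun=> x), (fun=> iota l%:P).
    by split=> [//|_|]; [apply: liftC | rewrite big_ord1].
  (* Testing on the product 1 * 1 shows that y is a polynomial r. *)
  have [r _ rE] := yM _ _ F1 J1; rewrite polyC1 rmorph1 !mulr1 in rE.
  have r0 : r`_0 = 0.
    apply: (Jhull WW) => l Jl; split.
      have := yM _ _ F1 Jl.
      by rewrite mul1r -rE -rmorphM => /lift_setP; rewrite coef0M coefC eqxx.
    have := yM _ _ Ft Jl.
    by rewrite -rE -!rmorphM => /lift_setP; rewrite !coef0M !coefC eqxx.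
  rewrite mulr_sumr; elim/big_ind: _; [exact: lift_set0|exact: lift_setD|].
  move=> i _; have [p ->] := FB _ (Fe i); have [q _ <-] := Tb i.
  rewrite -rE -!rmorphM; apply/lift_setP; rewrite coef0M r0 mul0r.
  by case: Wsub.
have {}abF : pullback_star (lift [set: L]) `<=` pullback_star (lift J).
  apply: abF; rewrite -[X in _ `<=` X]family_star_idem.
  exact: family_star_mono.
have [l Jl] := Jproper; apply: Jl.
have /abF lJ : pullback_star (lift [set: L]) (iota l%:P).
  by apply: sub_family_star; apply: liftC.
(* The multiplier 1 and [lift J] itself separate the constant l, chosen outside [J]. *)
have := lJ 1 (lift J); rewrite mul1r => /(_ (oner_neq0 _)) [].
- by exists J => //; right.
- by move=> e; rewrite mul1r.
- by move=> p Jp /frac_of_poly_inj pl; move: Jp; rewrite pl /= coefC eqxx.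
Qed.

End PullbackStar.

(** * Polynomials and simple poles in F(x) *)

Section RationalFunctions.
Variables (F : fieldType) (a : nat -> F).
Hypothesis a_inj : injective a.

Local Notation L := {fraction {poly F}}.

Definition constant_frac : {pred L} :=
  fun x => `[< exists c : F, x = (c%:P)%:F >].

Lemma constant_frac_divring_closed : divring_closed constant_frac.
Proof.
split=> [|_ _ /asboolP[c ->] /asboolP[d ->]|_ _ /asboolP[c ->] /asboolP[d ->]].
- by apply/asboolP; exists 1; rewrite polyC1 rmorph1.
- by apply/asboolP; exists (c - d); rewrite polyCB rmorphB.
- apply/asboolP; exists (c / d).
  (* The composite embedding of F into L is a ring morphism of fields, so it commutes with
     division. *)
  by rewrite -[RHS]/((@FracField.tofrac {poly F} \o polyC) _) fmorph_div.
Qed.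

HB.instance Definition _ :=
  GRing.isDivringClosed.Build L constant_frac constant_frac_divring_closed.

Definition poly_deg_le (m : nat) : set L :=
  [set p%:F | p in [set p : {poly F} | (size p <= m.+1)%N]].

Lemma poly_deg_leP m (p : {poly F}) :
  poly_deg_le m p%:F <-> (size p <= m.+1)%N.
Proof. by split=> [[q qm /tofrac_inj<-]//|]; exists p. Qed.

Lemma poly_deg_leE : poly_deg_le 0 = [set` constant_frac].
Proof.
apply/seteqP; split=> [_ [p p1 <-]|x /asboolP[c ->]].
  by apply/asboolP; exists p`_0; rewrite -size1_polyC.
by apply/poly_deg_leP; exact: size_polyC_leq1.
Qed.

Lemma poly_deg_le_subspace m : subspace constant_frac (poly_deg_le m).
Proof.
split.
- by exists 0; rewrite ?rmorph0 //= size_poly0.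
- move=> _ _ [p /= pm <-] [q /= qm <-]; rewrite -rmorphD; apply/poly_deg_leP.
  by rewrite (leq_trans (size_polyD _ _)) // geq_max pm.
- move=> _ _ /asboolP[c ->] [p /= pm <-]; rewrite -rmorphM; apply/poly_deg_leP.
  by rewrite mul_polyC (leq_trans (size_scale_leq _ _)).
Qed.

Lemma poly_deg_le1 m : poly_deg_le m 1.
Proof. by exists 1; rewrite ?rmorph1 //= size_poly1. Qed.

Lemma poly_deg_leM m n x y :
  poly_deg_le m x -> poly_deg_le n y -> poly_deg_le (m + n) (x * y).
Proof.
move=> [p /= pm <-] [q /= qn <-]; rewrite -rmorphM; apply/poly_deg_leP.
rewrite (leq_trans (size_polyMleq _ _)) //.
by move: (size p) (size q) pm qn => i j; lia.
Qed.

(** Testing q = 1 makes c a polynomial, and q = x^m then bounds its degree. *)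
Lemma poly_deg_le_colon m n c :
  (forall q, poly_deg_le m q -> poly_deg_le (m + n) (c * q)) -> poly_deg_le n c.
Proof.
move=> cP; have [p _ pc] := cP _ (poly_deg_le1 m).
rewrite mulr1 in pc; rewrite -pc; apply/poly_deg_leP.
have /cP : poly_deg_le m ('X^m)%:F by apply/poly_deg_leP; rewrite size_polyXn.
rewrite -pc -rmorphM => /poly_deg_leP.
have [->|p0] := eqVneq p 0; first by rewrite size_poly0.
by rewrite size_mulXn // -addnS leq_add2l.
Qed.

(** Unimodularity of [v] makes c a polynomial; then c q has degree at most that of c v_j, which is
    at most r. *)
Lemma poly_deg_le_hull n (v b : 'I_n -> {poly F}) j c r q :
  \sum_(i < n) b i * v i = 1 -> v j != 0 ->
  (forall i, poly_deg_le r (c * (v i)%:F)) ->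
  poly_deg_le (size (v j)).-1 q -> poly_deg_le r (c * q).
Proof.
move=> bv vj0 cv [s /= sv <-].
have /choice[w wP] : forall i, exists w : {poly F}, w%:F = c * (v i)%:F.
  by move=> i; have [w _ wE] := cv i; exists w.
have cE : c = (\sum_(i < n) b i * w i)%:F.
  rewrite -[LHS]mulr1 -(rmorph1 (@FracField.tofrac {poly F})) -bv.
  rewrite !rmorph_sum mulr_sumr.
  by apply: eq_bigr => i _; rewrite !rmorphM /= wP mulrCA.
move: (cv j); rewrite cE -!rmorphM => /poly_deg_leP cvj; apply/poly_deg_leP.
set p := \sum_(i < n) _ in cvj *.
have [->|p0] := eqVneq p 0; first by rewrite mul0r size_poly0.
rewrite prednK ?size_poly_gt0 // in sv.
rewrite (leq_trans (size_polyMleq _ _)) // (leq_trans _ cvj) // size_mul //.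
by rewrite -!subn1 leq_sub2r // leq_add2l.
Qed.

Definition pole_poly N : {poly F} := \prod_(i < N) ('X - (a i)%:P).

Lemma size_pole_poly N : size (pole_poly N) = N.+1.
Proof. by rewrite size_prod_XsubC /index_enum -enumT size_enum_ord. Qed.

Lemma pole_poly_neq0 N : pole_poly N != 0.
Proof. by rewrite -size_poly_gt0 size_pole_poly. Qed.

Lemma pole_polyD N d :
  pole_poly (N + d) = pole_poly N * \prod_(i < d) ('X - (a (N + i))%:P).
Proof. by rewrite /pole_poly big_split_ord. Qed.

(* The Riemann-Roch space of the divisor sum_i (a i) on the projective line. *)
Definition simple_poles : set L :=
  [set x | exists N, poly_deg_le N (x * (pole_poly N)%:F)].

(** The M - N further linear factors raise the degree by at most M - N, so the spaces for successive
    N form a chain. *)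
Lemma simple_poles_widen N M x : (N <= M)%N ->
  poly_deg_le N (x * (pole_poly N)%:F) -> poly_deg_le M (x * (pole_poly M)%:F).
Proof.
move=> /subnKC <-; rewrite pole_polyD rmorphM mulrA => NP.
apply: poly_deg_leM => //; apply/poly_deg_leP.
by rewrite size_prod_XsubC /index_enum -enumT size_enum_ord.
Qed.

Lemma simple_poles_subspace : subspace constant_frac simple_poles.
Proof.
split.
- by exists 0%N; rewrite mul0r; have [] := poly_deg_le_subspace 0.
- move=> x y [N xN] [M yM]; exists (maxn N M); rewrite mulrDl.
  have [_ PD _] := poly_deg_le_subspace (maxn N M); apply: PD.
    exact: simple_poles_widen (leq_maxl _ _) xN.
  exact: simple_poles_widen (leq_maxr _ _) yM.
- move=> c x kc [N xN]; exists N; rewrite -mulrA.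
  by have [_ _] := poly_deg_le_subspace N; apply.
Qed.

Lemma simple_poles1 : simple_poles 1.
Proof.
by exists 0%N; rewrite /pole_poly big_ord0 rmorph1 mulr1; apply: poly_deg_le1.
Qed.

Lemma simple_polesV N : simple_poles ((pole_poly N)%:F)^-1.
Proof.
exists N; rewrite mulVf ?tofrac_eq0 ?pole_poly_neq0 //; exact: poly_deg_le1.
Qed.

(** A nonconstant polynomial has a pole at infinity, which the degree bound excludes. *)
Lemma simple_poles_poly (p : {poly F}) : simple_poles p%:F -> (size p <= 1)%N.
Proof.
move=> [N]; rewrite -rmorphM => /poly_deg_leP.
have [->|p0] := eqVneq p 0; first by rewrite size_poly0.
rewrite size_mul ?pole_poly_neq0 // size_pole_poly addnS /=.
by rewrite -(add1n N) leq_add2r.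
Qed.

Lemma simple_poles_hull n (w : 'I_n -> L) : (exists i, w i != 0) ->
  exists u m, [/\ u != 0, forall i, poly_deg_le m (u * w i) &
    forall c W, subspace_family poly_deg_le simple_poles W ->
    (forall i, W (c * (u * w i))) ->
    forall q, poly_deg_le m q -> W (c * q)].
Proof.
move=> w_neq0.
have fracF (x : L) : exists p q : {poly F}, q != 0 /\ x = p%:F / q%:F.
  exact: fractionP.
have [f [v [b [f0 wv bv]]]] := frac_unimodular (@tofrac_inj _) fracF w_neq0.
have uw i : f^-1 * w i = (v i)%:F by rewrite wv mulKf.
(* The hull takes for m the largest degree among the [v i], attained at j. *)
have [j vj] : {j | \max_(i < n) size (v i) = size (v j)}.
  apply: eq_bigmax; rewrite card_ord; case: w_neq0 => i _.
  exact: leq_ltn_trans (ltn_ord i).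
have v_le i : (size (v i) <= size (v j))%N by rewrite -vj leq_bigmax.
have vj0 : v j != 0.
  have [i wi] := w_neq0; rewrite -size_poly_gt0 (leq_trans _ (v_le i)) //.
  rewrite size_poly_gt0; apply: contra_neq wi => vi0.
  by rewrite wv vi0 rmorph0 mulr0.
exists f^-1, (size (v j)).-1; split; first by rewrite invr_eq0.
  by move=> i; rewrite uw; apply/poly_deg_leP; rewrite prednK ?size_poly_gt0.
move=> c W WW cW q qP.
have cvW i : W (c * (v i)%:F) by rewrite -uw; exact: cW.
case: WW cvW {cW} => [[r ->]|->] cW.
  exact: (poly_deg_le_hull bv vj0 cW qP).
have /choice[N cN] := cW.
(* The finitely many conditions share one bound N; with c times [pole_poly N] as multiplier, this
   case reduces to that of polynomials. *)
exists (\max_(i < n) N i); rewrite mulrAC.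
apply: (poly_deg_le_hull bv vj0 _ qP) => i.
rewrite mulrAC; apply: simple_poles_widen (cN i); exact: leq_bigmax.
Qed.

(** Write pi_N for [pole_poly N]. As 1 is in the space, c = p / pi_N with deg p <= N. As 1 / pi_N is
    in it, p / pi_N^2 has simple poles only, so pi_N divides p, and the quotient is a constant. *)
Lemma simple_poles_mul_closed c :
  (forall x, simple_poles x -> simple_poles (c * x)) ->
  exists d : F, c = (d%:P)%:F.
Proof.
move=> cJ; have [N] := cJ _ simple_poles1.
rewrite mulr1 => -[p /= pN pc].
have pi0 M : (pole_poly M)%:F != 0 :> L by rewrite tofrac_eq0 pole_poly_neq0.
have [M cM] := cJ _ (simple_polesV N).
have NM : (N <= N + M)%N by apply: leq_addr.
have [q _ qE] := simple_poles_widen (leq_addl N M) cM.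
pose s := \prod_(i < M) ('X - (a (N + i))%:P).
have ps : p * s = q * pole_poly N.
  apply: tofrac_inj; rewrite !rmorphM /= pc qE pole_polyD rmorphM -/s /=.
  by rewrite mulrA divfK // mulrAC.
have /dvdpP[r pr] : pole_poly N %| p.
  have polesE : pole_poly N = \prod_(z <- map a (iota 0 N)) ('X - z%:P).
    by rewrite big_map -[in iota _ _](subn0 N) big_mkord.
  rewrite polesE; apply: uniq_roots_dvdp; last first.
    by rewrite uniq_rootsE map_inj_uniq // iota_uniq.
  (* The factor s vanishes only at points a_i with i >= N, which differ from a_0, ..., a_(N-1), so
     the latter are roots of p. *)
  apply/allP => z zN; have : root (p * s) z.
    by rewrite ps rootM polesE root_prod_XsubC zN orbT.
  rewrite rootM => /orP[//|]; rewrite /root horner_prod => /prodf_eq0[l _].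
  rewrite hornerXsubC subr_eq0; case/mapP: zN => i.
  by rewrite mem_iota => iN -> /eqP/a_inj; lia.
have := pN; rewrite pr.
have [r0|r0] := eqVneq r 0.
  exists 0; apply: (mulIf (pi0 N)).
  by rewrite -pc pr r0 !rmorph0 !mul0r rmorph0.
rewrite size_mul ?pole_poly_neq0 // size_pole_poly addnS /=.
rewrite -(add1n N) leq_add2r.
move=> /size1_polyC rc; exists r`_0; rewrite -rc.
by apply: (mulIf (pi0 N)); rewrite -pc pr rmorphM.
Qed.

(** If W consists of polynomials, c and all c / pi_N are polynomials, which is absurd for large N
    unless c = 0. If W is [simple_poles], c is a constant, and c x has a pole at infinity unless c =
    0. *)
Lemma simple_poles_family_eq0 c W :
  subspace_family poly_deg_le simple_poles W ->
  (forall x, simple_poles x -> W (c * x) /\ W (c * ('X%:F * x))) -> c = 0.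
Proof.
move=> [[r ->]|->] cJ.
  have [[p /= _ pc] _] := cJ _ simple_poles1; rewrite mulr1 in pc.
  have pi0 M : (pole_poly M)%:F != 0 :> L by rewrite tofrac_eq0 pole_poly_neq0.
  (* The size of p exceeds its degree, which forces q = 0. *)
  have [[q /= _ qE] _] := cJ _ (simple_polesV (size p)).
  have pq : p = q * pole_poly (size p).
    by apply: tofrac_inj; rewrite rmorphM /= qE pc divfK.
  rewrite -pc; apply/eqP; rewrite tofrac_eq0; apply/eqP.
  have [q0|q0] := eqVneq q 0; first by rewrite pq q0 mul0r.
  have := congr1 (fun p : {poly F} => size p) pq.
  rewrite size_mul ?pole_poly_neq0 // size_pole_poly addnS /= => /eqP.
  by rewrite -[X in X == _]add0n eqn_add2r eq_sym size_poly_eq0 (negPf q0).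
have [d cd] : exists d : F, c = (d%:P)%:F.
  by apply: simple_poles_mul_closed => x /cJ[].
have [_] := cJ _ simple_poles1; rewrite mulr1 cd -rmorphM => /simple_poles_poly.
have [->|d0] := eqVneq d 0; first by rewrite polyC0 rmorph0.
by rewrite mul_polyC size_scale // size_polyX.
Qed.

Lemma simple_poles_proper : exists l, ~ simple_poles l.
Proof. by exists 'X%:F => /simple_poles_poly; rewrite size_polyX. Qed.

End RationalFunctions.

Theorem mainTheorem4 :
  exists (D : idomainType) (star : set {fraction D} -> set {fraction D}),
    [/\ star_operation star, eab star & ~ ab star].
Proof.
(* In characteristic zero the natural numbers supply infinitely many distinct poles. *)
pose a (n : nat) : rat := n%:R.
have a_inj : injective a by move=> m n /eqP; rewrite Num.Theory.eqr_nat => /eqP.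
exists (pullback (@constant_frac rat)).
exists (pullback_star (@poly_deg_le rat) (simple_poles a)).
split.
- apply: pullback_starP.
  + exact: poly_deg_leE.
  + exact: poly_deg_le_subspace.
  + exact: simple_poles_subspace.
- apply: pullback_star_eab.
  + exact: poly_deg_le_subspace.
  + exact: poly_deg_le1.
  + exact: poly_deg_leM.
  + exact: poly_deg_le_colon.
  + exact: simple_poles_hull.
- apply: (@pullback_star_not_ab _ _ _ _ 'X%:F).
  + exact: poly_deg_le_subspace.
  + exact: simple_poles_subspace.
  + exact: simple_poles1.
  + exact: simple_poles_proper.
  + exact: simple_poles_family_eq0.
Qed.
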